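(* Let $n\ge2$ and let $G\cong N_{2,n}(\mathbb{Z})$, i.e. let $G$ be a free nilpotent group of rank $n$ and class $2$. There is a $QN_{2,n}$ group $H$ such that $G\equiv H$ (elementary equivalence of groups) but $H$ is not an $N_{2,n}$ group over any commutative associative ring (with unit).
   Context: Two structures in the same language are elementarily equivalent ($\equiv$) if they satisfy the same first-order sentences. $R^+$ is the additive group of $R$. For abelian groups $A,B$, a 2-cocycle is a function $f:B\times B\to A$ with $f(0,x)=f(x,0)=0$ and $f(x+y,z)+f(x,y)=f(x,y+z)+f(y,z)$; it is symmetric if $f(x,y)=f(y,x)$ for all $x,y\in B$. For a ring $R$ with unit and symmetric 2-cocycles $f^1,\ldots,f^n:R^+\times R^+\to\bigoplus_{1\le j<k\le n}R^+$ with coordinates $f^i_{jk}$, $N_{2,n}(R,f^1,\ldots,f^n)$ is the set of all tuples $((\alpha_i)_{1\le i\le n},(\gamma_{ij})_{1\le i<j\le n})$ of elements of $R$ with the group multiplication $$((\alpha_i),(\gamma_{ij}))\odot((\beta_i),(\gamma'_{ij}))=\Big((\alpha_i+\beta_i),\big(\gamma_{ij}+\gamma'_{ij}+\alpha_i\beta_j+\sum_{k=1}^n f^k_{ij}(\alpha_k,\beta_k)\big)\Big).$$ $N_{2,n}(R)$ is this group with all $f^i=0$. A $QN_{2,n}$ group is a group isomorphic to $N_{2,n}(R,f^1,\ldots,f^n)$ for some ring $R$ with unit and some symmetric 2-cocycles $f^i$. An $N_{2,n}$ group over $R$ is a group isomorphic to $N_{2,n}(R)$. *)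

(* Defs.v *)
From HB Require Import structures.
From mathcomp Require Import all_boot all_algebra.

Set Implicit Arguments.
Unset Strict Implicit.
Unset Printing Implicit Defensive.

Import GRing.Theory.

(* First-order language of groups. Formulas are well-scoped de Bruijn terms: *)
(* the free variables of [t : gterm k], [p : gformula k] range over 'I_k, and *)
(* a quantifier binds variable 0 of its body.                                *)
Inductive gterm (k : nat) : Type :=
  | GVar of 'I_k
  | GOne
  | GMul of gterm k & gterm k
  | GInv of gterm k.

Inductive gformula : nat -> Type :=
  | GEq k of gterm k & gterm k : gformula k
  | GNot k of gformula k : gformula k
  | GAnd k of gformula k & gformula k : gformula k
  | GOr k of gformula k & gformula k : gformula k
  | GImp k of gformula k & gformula k : gformula k
  | GAll k of gformula k.+1 : gformula k
  | GEx k of gformula k.+1 : gformula k.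

Definition gsentence := gformula 0.

Section Satisfaction.
Variable G : groupType.

Definition env_cons k (x : G) (e : 'I_k -> G) (i : 'I_k.+1) : G :=
  if unlift ord0 i is Some j then e j else x.

Definition env_nil (i : 'I_0) : G := 1%g.

Fixpoint gteval k (e : 'I_k -> G) (t : gterm k) : G :=
  match t with
  | GVar i => e i
  | GOne => 1
  | GMul t1 t2 => gteval e t1 * gteval e t2
  | GInv t1 => (gteval e t1)^-1
  end%g.

Fixpoint gholds k (p : gformula k) : ('I_k -> G) -> Prop :=
  match p with
  | GEq _ t1 t2 => fun e => gteval e t1 = gteval e t2
  | GNot _ q => fun e => ~ gholds q e
  | GAnd _ q r => fun e => gholds q e /\ gholds r e
  | GOr _ q r => fun e => gholds q e \/ gholds r e
  | GImp _ q r => fun e => gholds q e -> gholds r e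
  | GAll _ q => fun e => forall x, gholds q (env_cons x e)
  | GEx _ q => fun e => exists x, gholds q (env_cons x e)
  end.

Definition gsatisfies (p : gsentence) : Prop := gholds p env_nil.

End Satisfaction.

Definition elem_equiv (G H : groupType) : Prop :=
  forall p : gsentence, gsatisfies G p <-> gsatisfies H p.

Definition group_isomorphic (G H : groupType) : Prop :=
  exists2 f : G -> H, bijective f & {morph f : x y / (x * y)%g}.

Local Open Scope ring_scope.

Record sym_cocycle (B A : zmodType) : Type := SymCocycle {
  cocycle_fun :> B -> B -> A;
  cocycle0l : forall x, cocycle_fun 0 x = 0;
  cocycle0r : forall x, cocycle_fun x 0 = 0;
  cocycleD : forall x y z,
    cocycle_fun (x + y) z + cocycle_fun x y
    = cocycle_fun x (y + z) + cocycle_fun y z;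
  cocycleC : forall x y, cocycle_fun x y = cocycle_fun y x
}.

Definition zero_cocycle (B A : zmodType) : sym_cocycle B A.
Proof. by exists (fun _ _ => 0) => // *; rewrite !addr0. Defined.

Notation ltpair n := {p : 'I_n * 'I_n | (p.1 < p.2)%N}.

(* [f] is a phantom parameter of the carrier: it selects the group law. *)
Record N2 (n : nat) (R : pzRingType)
    (f : 'I_n -> sym_cocycle R {ffun ltpair n -> R}) : Type := MkN2 {
  N2_alpha : {ffun 'I_n -> R};
  N2_gamma : {ffun ltpair n -> R}
}.
Arguments N2 {n R} f.
Arguments MkN2 {n R} f.

Section N2Group.
Variables (n : nat) (R : pzRingType).
Variable f : 'I_n -> sym_cocycle R {ffun ltpair n -> R}.
Local Notation N2 := (N2 f).
Local Notation MkN2 := (MkN2 f).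

Definition N2_pair (x : N2) := (N2_alpha x, N2_gamma x).
Definition N2_of_pair u := MkN2 u.1 u.2.
Lemma N2_pairK : cancel N2_pair N2_of_pair. Proof. by case. Qed.

HB.instance Definition _ := Choice.copy N2 (can_type N2_pairK).

Definition N2_mul (x y : N2) : N2 :=
  MkN2
    [ffun i => N2_alpha x i + N2_alpha y i]
    [ffun p : ltpair n =>
      N2_gamma x p + N2_gamma y p
      + N2_alpha x (val p).1 * N2_alpha y (val p).2
      + \sum_(k < n) f k (N2_alpha x k) (N2_alpha y k) p].

Definition N2_one : N2 := MkN2 0 0.

Definition N2_inv (x : N2) : N2 :=
  MkN2
    [ffun i => - N2_alpha x i]
    [ffun p : ltpair n =>
      - N2_gamma x p + N2_alpha x (val p).1 * N2_alpha x (val p).2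
      - \sum_(k < n) f k (N2_alpha x k) (- N2_alpha x k) p].

Lemma N2_eqP (x y : N2) :
  N2_alpha x =1 N2_alpha y -> N2_gamma x =1 N2_gamma y -> x = y.
Proof. by case: x y => [a c] [b d] /= /ffunP-> /ffunP->. Qed.

Lemma N2_mulA : associative N2_mul.
Proof.
move=> x y z; apply: N2_eqP => [i|p] /=; first by rewrite !ffunE addrA.
rewrite !ffunE mulrDl mulrDr.
have E : \sum_(k < n) f k (N2_alpha x k) ([ffun i => N2_alpha y i + N2_alpha z i] k) p
    + \sum_(k < n) f k (N2_alpha y k) (N2_alpha z k) p
  = \sum_(k < n) f k ([ffun i => N2_alpha x i + N2_alpha y i] k) (N2_alpha z k) p
    + \sum_(k < n) f k (N2_alpha x k) (N2_alpha y k) p.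
  rewrite -!big_split /=; apply: eq_bigr => k _; rewrite !ffunE.
  have /ffunP/(_ p) := cocycleD (f k) (N2_alpha x k) (N2_alpha y k)
    (N2_alpha z k).
  by rewrite !ffunE => ->.
rewrite !addrA [LHS](ACl (1*2*3*6*7*4*(8*5)))/= E.
by rewrite [RHS](ACl (1*2*5*3*6*7*(8*4))).
Qed.

Lemma N2_mul1g : left_id N2_one N2_mul.
Proof.
move=> x; apply: N2_eqP => [i|p] /=; first by rewrite !ffunE add0r.
rewrite !ffunE add0r mul0r addr0 big1 ?addr0// => k _.
by rewrite ffunE cocycle0l ffunE.
Qed.

Lemma N2_mulg1 : right_id N2_one N2_mul.
Proof.
move=> x; apply: N2_eqP => [i|p] /=; first by rewrite !ffunE addr0.
rewrite !ffunE addr0 mulr0 addr0 big1 ?addr0// => k _.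
by rewrite ffunE cocycle0r ffunE.
Qed.

Lemma N2_mulVg : left_inverse N2_one N2_inv N2_mul.
Proof.
move=> x; apply: N2_eqP => [i|p] /=; first by rewrite !ffunE addNr.
rewrite !ffunE mulNr.
under [X in _ + X = _]eq_bigr do rewrite ffunE cocycleC.
by rewrite [LHS](ACl ((1*4)*(2*5)*(3*6)))/= addNr addrN addNr !addr0.
Qed.

Lemma N2_mulgV : right_inverse N2_one N2_inv N2_mul.
Proof.
move=> x; apply: N2_eqP => [i|p] /=; first by rewrite !ffunE addrN.
rewrite !ffunE mulrN.
under [X in _ + X = _]eq_bigr do rewrite ffunE.
by rewrite !addrA [LHS](ACl ((1*2)*(3*5)*(4*6)))/= addrN addrN addNr !addr0.
Qed.

HB.instance Definition _ :=
  isGroup.Build N2 N2_mulA N2_mul1g N2_mulg1 N2_mulVg N2_mulgV.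

End N2Group.

Definition is_QN2 (n : nat) (H : groupType) : Prop :=
  exists (R : pzRingType) (f : 'I_n -> sym_cocycle R {ffun ltpair n -> R}),
    group_isomorphic H (N2 f).

Definition N2_0 (n : nat) (R : pzRingType) : groupType :=
  N2 (fun _ : 'I_n => zero_cocycle R {ffun ltpair n -> R}).

Definition is_N2_over (n : nat) (R : pzRingType) (H : groupType) : Prop :=
  group_isomorphic H (N2_0 n R).

(* Main.v *)
Require Import Defs.
From HB Require Import structures.
From mathcomp Require Import all_boot all_order all_algebra.
From mathcomp Require Import boolp classical_sets filter.
From mathcomp Require Import zify ring.

(** Two facts pull in opposite directions.

    First, the cocycles of a QN group are invisible to first-order logic as
    soon as the additive group of the ring R looks like that of the integers:
    torsion-free, with R / mR = Z / mZ for all m ([integer_residues]).  Let U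
    be a nonprincipal ultrafilter on the natural numbers.  By Los's theorem
    N(R, f) is elementarily equivalent to its ultrapower, which is N(R^U, f^U)
    ([upow_N2]).  The ultrapower R^U has the same residues and, in addition,
    realises every coherent sequence of residues ([upow_complete]).  Such a
    group is the sum of its divisible part and of a copy of the profinite
    integers, hence has no nonsplit torsion-free extension by such a group:
    every symmetric cocycle on R^U is a coboundary ([cocycle_splits]), and
    N(R^U, f^U) is isomorphic to N(R^U), so that N(R, f) and N(R) are
    elementarily equivalent ([elem_equiv_N2]).

    Secondly, if R omits a coherent sequence of residues, then a nonsplit
    cocycle on R can leave a trace in the isomorphism type of the group.  In N(S),
    S any ring, an element that is a 2^k-th power modulo the centre for every k
    becomes a 2^k-th power for every k after multiplication by one central
    element ([N2_0_two_divisible]): set the central coordinates to 0.  A group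
    where this fails is not of the form N(S).

    It remains to find R with N(R) elementarily equivalent to N(Z), with an
    infinitely 2-divisible element d, and with a 2-adic residue that R omits.
    Let K = Z^U and d = [2^j].  A Skolem hull in K gives a countable subring R
    of K that contains d, with N(R) an elementary subgroup of N(K)
    ([countable_elementary_subring]).  Since R is countable, a diagonal
    argument gives integers a_j, converging 2-adically, whose limit is
    the residue of no element of R ([residue_diagonal]).  Let
    F [x_j] = [floor (x_j a_j / 2^j)] ([scaled_floor]).  Its additivity defect
    F (x + y) - F x - F y is 0 or 1, so it is a cocycle on R with values in R,
    although F itself leaves R: F d = [a_j].  The group H is N(R, f) for this
    f, put on the first generator and the first commutator coordinate.
    In H the element x = (d, 0, ...; 0) is a 2^k-th power modulo the centre for
    all k.  Subtracting F from the central coordinate embeds H into N(K); if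
    x z with z central were a 2^k-th power for all k, its central coordinate,
    an element of R, would be congruent to F d = [a_j] modulo all 2^k, which
    the choice of the a_j forbids. *)

Set Implicit Arguments.
Unset Strict Implicit.
Unset Printing Implicit Defensive.

Import Order.TTheory GRing.Theory Num.Theory.
Local Open Scope quotient_scope.

(** * Ultrapowers *)

Lemma nonprincipal_ultrafilter_exists :
  exists U : set_system nat, UltraFilter U /\ (\oo `<=` U)%classic.
Proof. exact: ultraFilterLemma. Qed.

Definition ufilter : set_system nat := sval (cid nonprincipal_ultrafilter_exists).

#[global] Instance ufilter_ultra : UltraFilter ufilter.
Proof. exact: (svalP (cid nonprincipal_ultrafilter_exists)).1. Qed.

#[global] Instance ufilter_filter : Filter ufilter.
Proof. exact: _. Qed.

Lemma ufilter_ge N : \forall j \near ufilter, (N <= j)%N.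
Proof.
by apply: (svalP (cid nonprincipal_ultrafilter_exists)).2; exists N.
Qed.

Lemma ufilterNN (P : nat -> Prop) :
  (\forall j \near ufilter, ~ P j) <-> ~ (\forall j \near ufilter, P j).
Proof.
split=> [nP yP|nP].
  by have [j []] := filter_ex (filterI nP yP).
by have [//|] := in_ultra_setVsetC [set j | P j] ufilter_ultra.
Qed.

Lemma ufilter_or (P Q : nat -> Prop) :
  (\forall j \near ufilter, P j \/ Q j) ->
  (\forall j \near ufilter, P j) \/ (\forall j \near ufilter, Q j).
Proof.
move=> PQ; have [|/ufilterNN nP] := pselect (\forall j \near ufilter, P j).
  by left.
by right; apply: filterS2 PQ nP => j [].
Qed.

Section Upow.
Variable T : choiceType.
Implicit Types x y z : nat -> T.

Definition ae_eq x y : bool := `[< \forall j \near ufilter, x j = y j >].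

Lemma ae_eq_equiv : equiv_class_of ae_eq.
Proof.
split=> [x|x y|y x z].
- by apply/asboolP; apply: filterE.
- by apply/idP/idP => /asboolP xy; apply/asboolP; apply: filterS xy => j ->.
- move=> /asboolP xy /asboolP yz; apply/asboolP.
  by apply: filterS2 xy yz => j -> ->.
Qed.

Canonical ae_eq_equivRel := EquivRelPack ae_eq_equiv.

Definition upow := {eq_quot ae_eq_equivRel}.
HB.instance Definition _ := Choice.on upow.

Definition ucls x : upow := \pi_upow x.

Lemma uclsP x y : ucls x = ucls y <-> \forall j \near ufilter, x j = y j.
Proof.
split=> [/eqmodP/asboolP //|xy].
by apply/eqmodP/asboolP.
Qed.

Definition urep (u : upow) : nat -> T := repr u.

Lemma urepK u : ucls (urep u) = u. Proof. exact: reprK. Qed.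

Lemma ucls_surj u : exists x, ucls x = u.
Proof. by exists (urep u); apply: urepK. Qed.

Lemma urep_ucls x : \forall j \near ufilter, urep (ucls x) j = x j.
Proof. by apply/uclsP; rewrite urepK. Qed.

End Upow.
Arguments ucls {T}.

(** The function may depend on the index, so that [umap] covers the internal
    functions of the ultrapower, such as multiplication by a nonstandard number. *)
Definition umap (T T' : choiceType) (h : nat -> T -> T') (u : upow T) : upow T' :=
  ucls (fun j => h j (urep u j)).
Definition umap2 (T1 T2 T' : choiceType) (h : T1 -> T2 -> T') (u : upow T1) (v : upow T2) :
   upow T' := ucls (fun j => h (urep u j) (urep v j)).

Lemma umapE (T T' : choiceType) (h : nat -> T -> T') x :
  umap h (ucls x) = ucls (fun j => h j (x j)).
Proof. by apply/uclsP; apply: filterS (urep_ucls x) => j ->. Qed.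

Lemma umap2E (T1 T2 T' : choiceType) (h : T1 -> T2 -> T') x y :
  umap2 h (ucls x) (ucls y) = ucls (fun j => h (x j) (y j)).
Proof.
by apply/uclsP; apply: filterS2 (urep_ucls x) (urep_ucls y) => j -> ->.
Qed.

Section UpowGroup.
Variable G : groupType.
Let mul : upow G -> upow G -> upow G := umap2 (fun x y : G => (x * y)%g).
Let one : upow G := ucls (fun=> 1%g).
Let inv : upow G -> upow G := umap (fun _ (x : G) => (x^-1)%g).

Lemma upow_mulgA : associative mul.
Proof.
move=> u v w; case: (ucls_surj u) (ucls_surj v) (ucls_surj w) => x <- [y <-] [z <-].
by rewrite /mul !umap2E; apply/uclsP; apply: filterE => j; rewrite mulgA.
Qed.
Lemma upow_mul1g : left_id one mul.
Proof.
move=> u; case: (ucls_surj u) => x <-.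
by rewrite /mul !umap2E; apply/uclsP; apply: filterE => j; rewrite mul1g.
Qed.
Lemma upow_mulg1 : right_id one mul.
Proof.
move=> u; case: (ucls_surj u) => x <-.
by rewrite /mul !umap2E; apply/uclsP; apply: filterE => j; rewrite mulg1.
Qed.
Lemma upow_mulVg : left_inverse one inv mul.
Proof.
move=> u; case: (ucls_surj u) => x <-; rewrite /mul /inv !umapE !umap2E.
by apply/uclsP; apply: filterE => j; rewrite mulVg.
Qed.
Lemma upow_mulgV : right_inverse one inv mul.
Proof.
move=> u; case: (ucls_surj u) => x <-; rewrite /mul /inv !umapE !umap2E.
by apply/uclsP; apply: filterE => j; rewrite mulgV.
Qed.
HB.instance Definition _ :=
  isGroup.Build (upow G) upow_mulgA upow_mul1g upow_mulg1 upow_mulVg upow_mulgV.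

Lemma ucls_mulg (x y : nat -> G) : (ucls x * ucls y)%g = ucls (fun j => x j * y j)%g.
Proof. exact: umap2E. Qed.
Lemma ucls_invg (x : nat -> G) : ((ucls x)^-1)%g = ucls (fun j => (x j)^-1)%g.
Proof. exact: umapE. Qed.

End UpowGroup.

Section UpowRing.
Local Open Scope ring_scope.
Variable R : pzRingType.
Let add : upow R -> upow R -> upow R := umap2 (fun x y : R => x + y).
Let mul : upow R -> upow R -> upow R := umap2 (fun x y : R => x * y).
Let zero : upow R := ucls (fun=> 0).
Let one : upow R := ucls (fun=> 1).
Let opp : upow R -> upow R := umap (fun _ (x : R) => - x).

Ltac uring lem :=
  repeat (let u := fresh in move=> u; case: (ucls_surj u) => ? <- {u});
  rewrite /add /mul /opp ?umapE !umap2E; apply/uclsP; apply: filterE => ?; exact: lem.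

Lemma upow_addrA : associative add. Proof. uring addrA. Qed.
Lemma upow_addrC : commutative add. Proof. uring addrC. Qed.
Lemma upow_add0r : left_id zero add. Proof. uring add0r. Qed.
Lemma upow_addNr : left_inverse zero opp add. Proof. uring addNr. Qed.
HB.instance Definition _ :=
  GRing.isZmodule.Build (upow R) upow_addrA upow_addrC upow_add0r upow_addNr.
Lemma upow_mulrA : associative mul. Proof. uring mulrA. Qed.
Lemma upow_mul1r : left_id one mul. Proof. uring mul1r. Qed.
Lemma upow_mulr1 : right_id one mul. Proof. uring mulr1. Qed.
Lemma upow_mulrDl : left_distributive mul add. Proof. uring mulrDl. Qed.
Lemma upow_mulrDr : right_distributive mul add. Proof. uring mulrDr. Qed.
HB.instance Definition _ :=
  GRing.Zmodule_isPzRing.Build (upow R) upow_mulrA upow_mul1r upow_mulr1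
    upow_mulrDl upow_mulrDr.

Lemma uclsD (x y : nat -> R) : ucls x + ucls y = ucls (fun j => x j + y j).
Proof. exact: umap2E. Qed.
Lemma uclsM (x y : nat -> R) : ucls x * ucls y = ucls (fun j => x j * y j).
Proof. exact: umap2E. Qed.
Lemma uclsN (x : nat -> R) : - ucls x = ucls (fun j => - x j).
Proof. exact: umapE. Qed.
Lemma uclsMn (x : nat -> R) m : ucls x *+ m = ucls (fun j => x j *+ m).
Proof.
elim: m => [//|m IH]; rewrite mulrS IH uclsD.
by apply/uclsP; apply: filterE => j; rewrite mulrS.
Qed.
Lemma ucls_sum I (r : seq I) (x : I -> nat -> R) :
  \sum_(i <- r) ucls (x i) = ucls (fun j => \sum_(i <- r) x i j).
Proof.
elim: r => [|i r IH]; first by rewrite big_nil; apply/uclsP/filterE => j; rewrite big_nil.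
by rewrite big_cons IH uclsD; apply/uclsP/filterE => j; rewrite big_cons.
Qed.

End UpowRing.

(** * Elementary equivalence *)

Section Los.
Variable G : groupType.

Lemma gteval_ucls k (a : 'I_k -> nat -> G) (t : gterm k) :
  gteval (fun i => ucls (a i)) t = ucls (fun j => gteval (fun i => a i j) t).
Proof.
elim: t => [i|//|s IHs t IHt|t IHt] /=; first by [].
  by rewrite IHs IHt ucls_mulg.
by rewrite IHt ucls_invg.
Qed.

Lemma env_cons_ucls k (a : 'I_k -> nat -> G) (x : nat -> G) :
  env_cons (ucls x) (fun i => ucls (a i)) =
  fun i => ucls (fun j => env_cons (x j) (fun i => a i j) i).
Proof. by apply: funext => i; rewrite /env_cons; case: unlift. Qed.

(** The quantifier steps choose, for almost every index, a witness or a
    counterexample; negation and disjunction use that the filter is an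
    ultrafilter. *)
Lemma Los k (p : gformula k) (a : 'I_k -> nat -> G) :
  gholds p (fun i => ucls (a i)) <->
  \forall j \near ufilter, gholds p (fun i => a i j).
Proof.
elim: p a => {k} [k s t|k p IH|k p IHp q IHq|k p IHp q IHq|k p IHp q IHq|k p IH|k p IH] a /=.
- by rewrite !gteval_ucls; apply: uclsP.
- by rewrite IH; apply: iff_sym; apply: ufilterNN.
- rewrite IHp IHq; split=> [[P Q]|PQ]; first by apply: filterS2 P Q.
  by split; apply: filterS PQ => j [].
- rewrite IHp IHq; split=> [[P|Q]|]; last exact: ufilter_or.
    by apply: filterS P => j; left.
  by apply: filterS Q => j; right.
- rewrite IHp IHq; split=> [PQ|PQ P]; last by apply: filterS2 PQ P => j; apply.
  have [P|/ufilterNN nP] := pselect (\forall j \near ufilter, gholds p (fun i => a i j)).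
    by apply: filterS (PQ P).
  by apply: filterS nP.
- split=> [H|H u]; last first.
    case: (ucls_surj u) => x <-; rewrite env_cons_ucls; apply/IH.
    by apply: filterS H.
  apply: contrapT => /ufilterNN nH.
  have /choice[x xP] : forall j, exists x, ~ gholds p (env_cons x (fun i => a i j)) \/
      (forall x, gholds p (env_cons x (fun i => a i j))).
    move=> j; have [[x nx]|] := pselect (exists x, ~ gholds p (env_cons x (fun i => a i j))).
      by exists x; left.
    by move=> /forallNP h; exists 1%g; right => x; apply: contrapT.
  have := H (ucls x); rewrite env_cons_ucls => /IH {}H.
  have [j [Hj nHj]] := filter_ex (filterI H nH).
  by case: (xP j).
- split=> [[u]|H].
    case: (ucls_surj u) => x <-; rewrite env_cons_ucls => /IH.
    by apply: filterS => j; exists (x j).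
  have /choice[x xP] : forall j, exists x, (exists x, gholds p (env_cons x (fun i => a i j))) ->
      gholds p (env_cons x (fun i => a i j)).
    move=> j; have [[x nx]|nx] := pselect (exists x, gholds p (env_cons x (fun i => a i j))).
      by exists x.
    by exists 1%g.
  exists (ucls x); rewrite env_cons_ucls; apply/IH.
  by apply: filterS H => j; apply: xP.
Qed.

Lemma elem_equiv_upow : elem_equiv G (upow G).
Proof.
move=> p; rewrite /gsatisfies.
have -> : @env_nil (upow G) = fun i => ucls (fun=> env_nil G i).
  by apply: funext => -[].
rewrite Los; split=> H; first exact: filterE.
by have [j] := filter_ex H.
Qed.

End Los.

Section Morphism.
Variables (G H : groupType) (h : G -> H).
Hypothesis hM : {morph h : x y / (x * y)%g}.

Lemma morph_one : h 1%g = 1%g.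
Proof. by apply: (mulgI (h 1%g)); rewrite -hM !mulg1. Qed.

Lemma morph_inv x : h (x^-1)%g = ((h x)^-1)%g.
Proof. by apply: (mulgI (h x)); rewrite -hM !mulgV morph_one. Qed.

Lemma morph_exp x m : h (x ^+ m)%g = (h x ^+ m)%g.
Proof. by elim: m => [|m IH]; rewrite ?expg0 ?morph_one // !expgS hM IH. Qed.

End Morphism.

Section TarskiVaught.
Variables (G H : groupType) (h : G -> H).
Hypothesis h_inj : injective h.
Hypothesis hM : {morph h : x y / (x * y)%g}.

Lemma gteval_morph k (e : 'I_k -> G) (t : gterm k) :
  gteval (h \o e) t = h (gteval e t).
Proof. by elim: t => [i||s /= -> t ->|t /= ->] //=; rewrite ?hM ?(morph_one hM) ?(morph_inv hM). Qed.

Lemma env_cons_comp k (x : G) (e : 'I_k -> G) :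
  env_cons (h x) (h \o e) = h \o env_cons x e.
Proof. by apply: funext => i; rewrite /env_cons /=; case: unlift. Qed.

Hypothesis witness : forall k (p : gformula k.+1) (e : 'I_k -> G),
  (exists x, gholds p (env_cons x (h \o e))) ->
  exists x, gholds p (env_cons (h x) (h \o e)).

(** A universal quantifier over [H] is handled through the negated body: a
    counterexample in [H] would give one in [G]. *)
Lemma Tarski_Vaught k (p : gformula k) (e : 'I_k -> G) :
  gholds p (h \o e) <-> gholds p e.
Proof.
elim: p e => {k} [k s t|k p IH|k p IHp q IHq|k p IHp q IHq|k p IHp q IHq|k p IH|k p IH] e /=.
- by rewrite !gteval_morph; split=> [/h_inj|->].
- by rewrite IH.
- by rewrite IHp IHq.
- by rewrite IHp IHq.
- by rewrite IHp IHq.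
- split=> [P x|P y]; first by apply/IH; rewrite -env_cons_comp.
  apply: contrapT => nP.
  have [|x /=] := @witness _ (GNot p) e; first by exists y.
  by apply; rewrite env_cons_comp; apply/IH.
- split=> [/witness[x]|[x /IH P]].
    by rewrite env_cons_comp => /IH; exists x.
  by exists (h x); rewrite env_cons_comp.
Qed.

Lemma elem_equiv_Tarski_Vaught : elem_equiv G H.
Proof.
move=> p; rewrite /gsatisfies -Tarski_Vaught.
by have -> : h \o @env_nil G = @env_nil H by apply: funext => -[].
Qed.

End TarskiVaught.

Lemma elem_equiv_isomorphic (G H : groupType) : group_isomorphic G H -> elem_equiv G H.
Proof.
case=> h [h' hK h'K] hM; apply: (elem_equiv_Tarski_Vaught (can_inj hK) hM) => k p e [x].
by exists (h' x); rewrite h'K.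
Qed.

Lemma elem_equiv_sym (G H : groupType) : elem_equiv G H -> elem_equiv H G.
Proof. by move=> GH p; rewrite GH. Qed.

Lemma elem_equiv_trans (G H K : groupType) : elem_equiv G H -> elem_equiv H K -> elem_equiv G K.
Proof. by move=> GH HK p; rewrite GH. Qed.

(** * Groups defined by cocycles *)

Local Open Scope ring_scope.

Section Twist.
Variables (n : nat) (R S : pzRingType).
Variables (f : 'I_n -> sym_cocycle R {ffun ltpair n -> R}).
Variables (g : 'I_n -> sym_cocycle S {ffun ltpair n -> S}).
Variables (j : {rmorphism R -> S}) (T : 'I_n -> R -> ltpair n -> S).

(** One map for three uses: extension of scalars ([T = 0]), change of the cocycle by
    a coboundary ([j] the identity), and the embedding that untwists over a larger
    ring a cocycle that becomes a coboundary there. *)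
Definition N2_twist (x : N2 f) : N2 g :=
  MkN2 g [ffun i => j (N2_alpha x i)]
         [ffun p => j (N2_gamma x p) + \sum_(k < n) T k (N2_alpha x k) p].

Lemma N2_twistM :
  (forall k x y p,
    j (f k x y p) + T k (x + y) p = T k x p + T k y p + g k (j x) (j y) p) ->
  {morph N2_twist : x y / (x * y)%g}.
Proof.
move=> fTg x y; apply: N2_eqP => [i|p] /=; first by rewrite !ffunE rmorphD.
rewrite !ffunE !rmorphD rmorphM rmorph_sum -!addrA.
have -> : \sum_(k < n) j (f k (N2_alpha x k) (N2_alpha y k) p) +
    \sum_(k < n) T k (N2_alpha (x * y)%g k) p =
  \sum_(k < n) T k (N2_alpha x k) p + (\sum_(k < n) T k (N2_alpha y k) p +
    \sum_(k < n) g k ([ffun i => j (N2_alpha x i)] k) ([ffun i => j (N2_alpha y i)] k) p).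
  rewrite -!big_split /=; apply: eq_bigr => k _.
  by rewrite !ffunE fTg addrA.
by rewrite !addrA [LHS](ACl (1*4*2*5*3*6)).
Qed.

Lemma N2_twist_inj : injective j -> injective N2_twist.
Proof.
move=> j_inj x y [/ffunP Ea /ffunP Eg].
have Eal i : N2_alpha x i = N2_alpha y i.
  by apply: j_inj; have := Ea i; rewrite !ffunE.
apply: N2_eqP => // p; apply: j_inj; have := Eg p; rewrite !ffunE.
under eq_bigr do rewrite Eal.
exact: addIr.
Qed.

End Twist.

Section Coboundary.
Variables (n : nat) (R : pzRingType).
Variables (f g : 'I_n -> sym_cocycle R {ffun ltpair n -> R}).

Lemma N2_cohomologous (T : 'I_n -> R -> ltpair n -> R) :
  (forall k x y p, f k x y p + T k (x + y) p = T k x p + T k y p + g k x y p) ->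
  group_isomorphic (N2 f) (N2 g).
Proof.
move=> fTg; exists (N2_twist (f := f) g idfun T); last exact: N2_twistM.
exists (N2_twist (f := g) f idfun (fun k x p => - T k x p)) => x;
  apply: N2_eqP => [i|p] /=; rewrite !ffunE //= sumrN.
  by under [X in _ - X]eq_bigr do rewrite ffunE; rewrite addrK.
by under [X in _ + X]eq_bigr do rewrite ffunE; rewrite subrK.
Qed.

End Coboundary.

Section UpowN2.
Variables (n : nat) (R : pzRingType).
Variables (f : 'I_n -> sym_cocycle R {ffun ltpair n -> R}).
Variables (g : 'I_n -> sym_cocycle (upow R) {ffun ltpair n -> upow R}).
Hypothesis fg : forall k x y p,
  g k (ucls x) (ucls y) p = ucls (fun i => f k (x i) (y i) p).

(** Ultrapowers commute with the finite products of coordinates, because almost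
    every index is good for all of the finitely many coordinates at once. *)
Lemma upow_N2 : group_isomorphic (upow (N2 f)) (N2 g).
Proof.
pose F (u : upow (N2 f)) : N2 g :=
  MkN2 g [ffun i => umap (fun _ x => N2_alpha x i) u]
         [ffun p => umap (fun _ x => N2_gamma x p) u].
pose F' (x : N2 g) : upow (N2 f) :=
  ucls (fun j => MkN2 f [ffun i => urep (N2_alpha x i) j]
                        [ffun p => urep (N2_gamma x p) j]).
exists F.
  exists F' => [u|x]; last first.
    apply: N2_eqP => [i|p]; rewrite /= ffunE /F' umapE -[RHS]urepK;
      by apply/uclsP/filterE => j /=; rewrite ffunE.
  case: (ucls_surj u) => x <-; apply/uclsP.
  have Ha : \forall j \near ufilter,
      forall i, urep (N2_alpha (F (ucls x)) i) j = N2_alpha (x j) i.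
    apply: filter_forall => i; rewrite /= ffunE umapE.
    exact: urep_ucls.
  have Hg : \forall j \near ufilter,
      forall p, urep (N2_gamma (F (ucls x)) p) j = N2_gamma (x j) p.
    apply: filter_forall => p; rewrite /= ffunE umapE.
    exact: urep_ucls.
  apply: filterS2 Ha Hg => j Ea Eg.
  by apply: N2_eqP => [i|p]; rewrite /= ffunE ?Ea ?Eg.
move=> u v; case: (ucls_surj u) (ucls_surj v) => x <- [y <-].
rewrite ucls_mulg; apply: N2_eqP => [i|p] /=.
  by rewrite !ffunE !umapE uclsD; apply/uclsP/filterE => j; rewrite ffunE.
rewrite !ffunE !umapE uclsM (uclsD (fun j => N2_gamma (x j) p)) uclsD.
under eq_bigr do rewrite !ffunE !umapE fg.
by rewrite ucls_sum uclsD; apply/uclsP/filterE => j; rewrite /= ffunE.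
Qed.

End UpowN2.

Lemma elem_equiv_upow_N2_0 n (R : pzRingType) : elem_equiv (N2_0 n R) (N2_0 n (upow R)).
Proof.
apply: (elem_equiv_trans (elem_equiv_upow _)).
apply: elem_equiv_isomorphic; apply: upow_N2 => k x y p.
by rewrite ffunE; apply/uclsP/filterE => j; rewrite ffunE.
Qed.

Section Center.
Variables (n : nat) (n_ge2 : (2 <= n)%N) (R : pzRingType).
Variables (f : 'I_n -> sym_cocycle R {ffun ltpair n -> R}).

Definition N2_gen (i : 'I_n) (r : R) : N2 f := MkN2 f [ffun k => if k == i then r else 0] 0.

(** Commuting with the generator of index [k != i] forces the [i]-th coordinate to
    vanish; the cocycles are symmetric and drop out of commutators. *)
Lemma N2_central (x : N2 f) : (forall y : N2 f, (x * y = y * x)%g) -> N2_alpha x = 0.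
Proof.
move=> xC; apply/ffunP => i; rewrite ffunE.
have [k ki] : exists k : 'I_n, k != i.
  have n0 : (0 < n)%N by apply: leq_trans n_ge2.
  have [i0|i0] := eqVneq (val i) 0%N.
    by exists (Ordinal n_ge2); apply/eqP => /(congr1 val) /=; rewrite i0.
  by exists (Ordinal n0); rewrite eq_sym.
have key (p : ltpair n) (y : N2 f) : N2_alpha x (val p).1 * N2_alpha y (val p).2
   = N2_alpha y (val p).1 * N2_alpha x (val p).2.
  have /(congr1 (fun z => N2_gamma z p)) := xC y; rewrite /= !ffunE.
  under eq_bigr do rewrite cocycleC.
  by move/addIr; rewrite [N2_gamma y p + _]addrC => /addrI.
case: (ltngtP i k) => [ik|ik|/val_inj ik]; last by rewrite ik eqxx in ki.
- have := key (exist _ (i, k) ik) (N2_gen k 1) => /=.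
  by rewrite !ffunE eqxx mulr1 eq_sym (negPf ki) mul0r.
- have := key (exist _ (k, i) ik) (N2_gen k 1) => /=.
  by rewrite !ffunE eqxx mul1r eq_sym (negPf ki) mulr0.
Qed.

Lemma N2_centralV (x : N2 f) : N2_alpha x = 0 -> forall y : N2 f, (x * y = y * x)%g.
Proof.
move=> x0 y; apply: N2_eqP => [i|p] /=; first by rewrite !ffunE addrC.
rewrite !ffunE x0; under eq_bigr do rewrite cocycleC; rewrite !ffunE mul0r mulr0.
by rewrite (addrC (N2_gamma x p)).
Qed.

End Center.

Lemma N2_alpha_expg n (R : pzRingType) (f : 'I_n -> sym_cocycle R {ffun ltpair n -> R})
  (x : N2 f) m i : N2_alpha (x ^+ m)%g i = N2_alpha x i *+ m.
Proof.
elim: m => [|m IH]; first by rewrite expg0 /= ffunE.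
by rewrite expgS /= ffunE IH mulrS.
Qed.

Lemma N2_0_gamma_expg n (R : pzRingType) (x : N2_0 n R) m p :
  N2_gamma (x ^+ m)%g p =
    N2_gamma x p *+ m + (N2_alpha x (val p).1 * N2_alpha x (val p).2) *+ 'C(m, 2).
Proof.
elim: m => [|m IH]; first by rewrite expg0 /= ffunE !mulr0n addr0.
rewrite expgS /= !ffunE N2_alpha_expg IH big1_eq addr0 binS bin1 mulrnAr.
by rewrite -addrA -addrA -mulrnDr mulrS -addrA.
Qed.

Definition two_divisible_mod_center (G : groupType) (x : G) :=
  forall k, exists y z : G, (forall w, z * w = w * z)%g /\ x = (y ^+ (2 ^ k) * z)%g.

(** The central element is chosen so as to set the central coordinates of [x] to 0.
    A 2^k-th root of the result has first coordinates [b i *+ 2 ^ k], where [b] is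
    a root of order 2^(2k), which makes the correction term of the power formula
    divisible by 2^k. *)
Lemma N2_0_two_divisible n (R : pzRingType) (n_ge2 : (2 <= n)%N) (x : N2_0 n R) :
  two_divisible_mod_center x ->
  exists z : N2_0 n R, (forall w, z * w = w * z)%g /\
     forall k, exists y, (x * z)%g = (y ^+ (2 ^ k))%g.
Proof.
move=> xdiv.
have adiv k : exists b : 'I_n -> R, forall i, N2_alpha x i = b i *+ (2 ^ k).
  have [y [z [/(N2_central n_ge2) z0 ->]]] := xdiv k.
  exists (N2_alpha y) => i; rewrite /= ffunE z0 ffunE addr0.
  exact: N2_alpha_expg.
exists (MkN2 _ 0 [ffun p => - N2_gamma x p]); split; first exact: N2_centralV.
move=> k; have [b bE] := adiv (k + k)%N.
pose y : N2_0 n R := MkN2 _ [ffun i => b i *+ (2 ^ k)]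
  [ffun p => - ((b (val p).1 * b (val p).2) *+ (2 ^ k * 'C(2 ^ k, 2)))].
exists y; apply: N2_eqP => [i|p]; rewrite ?N2_alpha_expg ?N2_0_gamma_expg /= !ffunE.
  by rewrite addr0 bE -mulrnA expnD.
rewrite big1_eq addr0 subrr mulr0 addr0 mulNrn mulrnAl mulrnAr -!mulrnA.
by rewrite [(2 ^ k * (_ * _))%N]mulnC addNr.
Qed.

Lemma iso_N2_0_two_divisible n (n_ge2 : (2 <= n)%N) (S : pzRingType) (G : groupType) (x : G) :
  is_N2_over n S G -> two_divisible_mod_center x ->
  exists z : G, (forall w, z * w = w * z)%g /\
     forall k, exists y, (x * z)%g = (y ^+ (2 ^ k))%g.
Proof.
case=> h [h' hK h'K] hM xdiv.
have [|z [zC zdiv]] := @N2_0_two_divisible n S n_ge2 (h x).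
  move=> k; have [y [z [zC ->]]] := xdiv k.
  exists (h y), (h z); split; last by rewrite hM (morph_exp hM).
  by move=> w; rewrite -(h'K w) -!hM zC.
exists (h' z); split=> [w|k]; first by apply: (can_inj hK); rewrite !hM h'K zC.
by have [y yE] := zdiv k; exists (h' y); apply: (can_inj hK); rewrite hM (morph_exp hM) !h'K.
Qed.

(** * Splitting of cocycles *)

Definition torsion_free (V : zmodType) := forall (x : V) m, x *+ m.+1 = 0 -> x = 0.

Section DivisibleComplement.
Variables (V : zmodType) (V_tf : torsion_free V).

Definition sub_closed (A : set V) := forall x y, A x -> A y -> A (x - y).

Lemma sub_closedMn A x m : sub_closed A -> A 0 -> A x -> A (x *+ m).
Proof.
move=> AB A0 Ax; elim: m => [//|m IH].
by rewrite mulrSr -[x in _ + x]opprK; apply/AB => //; rewrite -sub0r; apply: AB.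
Qed.

Variables E D : set V.
Hypotheses (E0 : E 0) (EB : sub_closed E) (D0 : D 0) (DB : sub_closed D).
Hypothesis DE : (D `<=` E)%classic.
Hypothesis D_div : forall x m, D x -> exists2 y, D y & x = y *+ m.+1.

(** [S] is maximal among the subgroups of [E] that meet [D] trivially.  By
    torsion-freeness and maximality [S] is closed under division in [E]; if
    [x] is not in [S], then maximality puts some [t + m x], with [t] in [S] and
    [m > 0], into [D], and dividing it by [m] in [D] gives the required [d]. *)
Lemma divisible_complement : exists S : set V,
  [/\ S 0, sub_closed S, (S `<=` E)%classic,
      forall x, S x -> D x -> x = 0
    & forall x, E x -> exists2 d, D d & S (x - d)].
Proof.
pose P (A : set V) := [/\ sub_closed A, (A `<=` E)%classic & forall x, A x -> D x -> x = 0].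
have [F FP Ftot|S [[SB SE SD] Smax]] := @Zorn_bigcup _ P.
  split=> [x y [A FA Ax] [B FB By]|x [A /FP[_ AE _] /AE]//|x [A /FP[_ _ AD] /AD]//].
  case: (Ftot _ _ FA FB) => [AB|BA].
    by exists B => //; have [BB _ _] := FP _ FB; apply: BB => //; apply: AB.
  by exists A => //; have [AB _ _] := FP _ FA; apply: AB => //; apply: BA.
have sup B x : P B -> (S `<=` B)%classic -> B x -> S x.
  move=> PB SsB Bx; apply: contrapT => nSx; apply: (Smax B) => //.
  by split=> // /(_ _ Bx).
have S0 : S 0.
  apply: contrapT => nS0; apply: (Smax [set 0]%classic).
    split=> [z Sz|/(_ 0 erefl)/nS0 //]; case: nS0; have := SB _ _ Sz Sz.
    by rewrite subrr.
  by split=> [x y -> ->|x ->|x ->] //; rewrite subrr.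
exists S; split=> // x Ex.
have S_divisible y m : E y -> S (y *+ m.+1) -> S y.
  move=> Ey Sy; apply: (sup [set z | E z /\ exists k, S (z *+ k.+1)]%classic);
    [split| |by split=> //; exists m].
  - move=> z t [Ez [k Sz]] [Et [l St]]; split; first exact: EB.
    exists (k.+1 * l.+1).-1; rewrite prednK ?muln_gt0 // mulrnBl {2}mulnC !mulrnA.
    by apply: (SB); apply: sub_closedMn.
  - by move=> z [].
  - move=> z [Ez [k Sz]] Dz; apply: (V_tf (m := k)); apply: (SD) => //.
    exact: sub_closedMn.
  - by move=> z Sz; split; [apply: (SE)|exists 0%N].
have [Sx|nSx] := pselect (S x); first by exists 0; rewrite ?subr0.
have [y [s [m [Ss yE Dy y0]]]] : exists y s m, [/\ S s, y = s + x *~ m, D y & y <> 0].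
  apply: contrapT => nex; apply: nSx.
  apply: (sup [set z | exists s m, S s /\ z = s + x *~ m]%classic); first split.
  - move=> _ _ [s [m [Ss ->]]] [t [l [St ->]]]; exists (s - t), (m - l).
    by split; [apply: (SB)|rewrite mulrzBr addrACA opprD].
  - have Ez m : E (x *~ m).
      case: m => m; first exact: sub_closedMn.
      by rewrite NegzE mulrNz -sub0r; apply: (EB) => //; apply: sub_closedMn.
    move=> _ [s [m [Ss ->]]]; rewrite -[x *~ m]opprK; apply: (EB); first exact: SE.
    by rewrite -mulrNz.
  - move=> z [s [m [Ss zE]]] Dz; apply: contrapT => z0; apply: nex.
    by exists z, s, m.
  - by move=> z Sz; exists z, 0; rewrite mulr0z addr0.
  - by exists 0, 1; rewrite add0r mulr1z.
have [k [t [St Dt]]] : exists k t, S t /\ D (t + x *+ k.+1).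
  case: m yE => [[|m]|m] yE.
  - by case: y0; apply: (SD) => //; rewrite yE mulr0z addr0.
  - by exists m, s; split=> //; rewrite yE in Dy.
  - exists m, (- s); split; first by rewrite -sub0r; apply: (SB).
    rewrite -[t in D t]opprK opprD opprK -sub0r; apply: DB => //.
    by rewrite yE NegzE mulrNz in Dy.
have [d Dd dE] := D_div k Dt; exists d => //; apply: (S_divisible _ k).
  by apply: (EB) => //; apply: DE.
rewrite mulrnBl -dE opprD addrCA subrr addr0 -sub0r.
exact: (SB).
Qed.

End DivisibleComplement.

(** The abelian extension of [K] by [A] defined by [f]; [f] occurs in the type only
    to select the group law. *)
Definition cocycle_ext (K A : zmodType) (f : sym_cocycle K A) : Type := (K * A)%type.

Section CocycleExtension.
Variables (K A : zmodType) (f : sym_cocycle K A).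
Local Notation cocycle_ext := (cocycle_ext f).

HB.instance Definition _ := Choice.copy cocycle_ext (K * A)%type.
Implicit Types x y z : cocycle_ext.

Definition cext_add x y : cocycle_ext := (x.1 + y.1, x.2 + y.2 + f x.1 y.1).
Definition cext_opp x : cocycle_ext := (- x.1, - x.2 - f x.1 (- x.1)).
Definition cext_zero : cocycle_ext := (0, 0).

Lemma cext_addA : associative cext_add.
Proof.
move=> x y z; congr pair => /=; first by rewrite addrA.
by rewrite !addrA [LHS](ACl (1*2*3*(5*4))) [RHS](ACl (1*2*4*(5*3)))/= cocycleD.
Qed.

Lemma cext_addC : commutative cext_add.
Proof.
by move=> x y; congr pair => /=; [exact: addrC|rewrite [x.2 + _]addrC cocycleC].
Qed.

Lemma cext_add0 : left_id cext_zero cext_add.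
Proof.
by case=> x a; congr pair; rewrite /= ?add0r // cocycle0l addr0.
Qed.

Lemma cext_addN : left_inverse cext_zero cext_opp cext_add.
Proof.
move=> x; congr pair; rewrite /= ?addNr // cocycleC.
by rewrite [LHS](ACl ((1*3)*(2*4))) /= !addNr addr0.
Qed.

HB.instance Definition _ :=
  GRing.isZmodule.Build cocycle_ext cext_addA cext_addC cext_add0 cext_addN.

Definition cext_proj x : K := x.1.
Lemma cext_proj_is_zmod_morphism : zmod_morphism cext_proj.
Proof. by []. Qed.
HB.instance Definition _ :=
  GRing.isZmodMorphism.Build cocycle_ext K cext_proj cext_proj_is_zmod_morphism.

Definition cext_inj (a : A) : cocycle_ext := (0, a).
Lemma cext_inj_is_zmod_morphism : zmod_morphism cext_inj.
Proof.
move=> a b; congr pair; rewrite /= ?subrr //.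
by rewrite !cocycle0l subr0 addr0.
Qed.
HB.instance Definition _ :=
  GRing.isZmodMorphism.Build A cocycle_ext cext_inj cext_inj_is_zmod_morphism.

Lemma cext_ker x : cext_proj x = 0 -> x = cext_inj x.2.
Proof. by case: x => x a /= ->. Qed.

Lemma cext_torsion_free : torsion_free K -> torsion_free A -> torsion_free cocycle_ext.
Proof.
move=> K_tf A_tf x m xm0.
have /cext_ker xE : cext_proj x = 0 by apply: (K_tf _ m); rewrite -raddfMn xm0 raddf0.
have : cext_inj (x.2 *+ m.+1) = 0 by rewrite raddfMn /= -xE.
by case=> /A_tf x20; rewrite xE x20.
Qed.

End CocycleExtension.

Lemma sub_eq_add3 (V : zmodType) (a b c a' b' c' : V) :
  a + b + c = a' + b' + c' -> a' - a + (b' - b) = c - c'.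
Proof.
move=> h; have E : a' + b' = a + b + (c - c') by rewrite addrA h addrK.
by rewrite addrACA -opprD E addrC addKr.
Qed.

Section Splitting.
Variables (K : zmodType) (K_tf : torsion_free K) (u : K).
Hypothesis K_res : forall x m, exists y i, x = y *+ m.+1 + u *~ i.
Hypothesis u_indiv : forall m i y, u *~ i = y *+ m.+1 -> exists c : int, i = c * m.+1%:Z.
Hypothesis K_complete : forall rho : nat -> int,
  (forall k l, (k <= l)%N -> exists c : int, rho l - rho k = c * k`!%:Z) ->
  exists y, forall k, exists z, y = u *~ rho k + z *+ k`!.

Variable f : sym_cocycle K K.
Notation E := (cocycle_ext f).
Let e1 : E := (u, 0).
Let proj_e1 (y : E) m i : cext_proj (y *+ m + e1 *~ i) = cext_proj y *+ m + u *~ i.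
Proof. by rewrite raddfD raddfMn raddfMz. Qed.
Let projB (x y : E) : cext_proj (x - y) = cext_proj x - cext_proj y.
Proof. exact: raddfB. Qed.
Let injDMn a b k : cext_inj f (a + b *+ k) = cext_inj f a + cext_inj f b *+ k.
Proof. by rewrite raddfD raddfMn. Qed.
Let E_tf : torsion_free E. Proof. exact: cext_torsion_free. Qed.

(* The elements of E whose residues are those of a multiple of (u, 0), to be
   thought of as the kernel of a morphism from E to the profinite integers
   that extends the residues of K and kills (u, 0). *)
Let E0 : set E := fun e => forall m, exists (y : E) (i : int), e = y *+ m.+1 + e1 *~ i.
Let D : set E := fun e => E0 e /\ cext_proj e = 0.

Let factE k : exists m, k`! = m.+1.
Proof. by exists (k`!).-1; rewrite prednK ?fact_gt0. Qed.

Let E0_0 : E0 0.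
Proof. by move=> m; exists 0, 0; rewrite mul0rn mulr0z addr0. Qed.

Let E0_B : sub_closed E0.
Proof.
move=> x y Ex Ey m; have [x' [i ->]] := Ex m; have [y' [k ->]] := Ey m.
by exists (x' - y'), (i - k); rewrite mulrnBl mulrzBr addrACA opprD.
Qed.

Let D_div x m : D x -> exists2 y, D y & x = y *+ m.+1.
Proof.
case=> Ex x0.
have div k : exists2 y : E, cext_proj y = 0 & x = y *+ k.+1.
  have [y [i xE]] := Ex k; have := x0; rewrite {1}xE proj_e1 => y0.
  have [c iE] : exists c : int, i = c * k.+1%:Z.
    apply: (u_indiv (y := - cext_proj y)); rewrite mulNrn.
    by apply/eqP; rewrite -addr_eq0 addrC y0.
  have xE' : x = (y + e1 *~ c) *+ k.+1 by rewrite xE mulrnDl iE mulrzA pmulrn.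
  exists (y + e1 *~ c) => //; apply: (@K_tf _ k).
  by rewrite -raddfMn -xE'.
have [y y0 xy] := div m; exists y => //; split=> // l.
have [z z0] := div (m.+1 * l.+1).-1.
rewrite prednK ?muln_gt0 // mulnC mulrnA xy => zE; exists z, 0.
rewrite mulr0z addr0; apply/eqP; rewrite -subr_eq0; apply/eqP; apply: (@E_tf _ m).
by rewrite mulrnBl zE subrr.
Qed.

(* The residues of e with respect to the image of K form a coherent sequence, so
   they are those of an element y of K. *)
Let E0_inj (e : E) : exists y, E0 (e - cext_inj f y).
Proof.
have approx k : exists i rho w, e = e1 *~ i + cext_inj f (u *~ rho) + w *+ k`!.
  have [m mE] := factE k.
  have [y [i yi]] := K_res (cext_proj e) m.
  pose y' : E := (y, 0).
  have [b [rho bE]] := K_res (e - e1 *~ i - y' *+ k`!).2 m.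
  exists i, rho, (y' + cext_inj f b).
  have /cext_ker : cext_proj (e - e1 *~ i - y' *+ k`!) = 0.
    by rewrite -addrA -opprD [X in _ - X]addrC projB proj_e1 mE -yi subrr.
  move/eqP; rewrite bE !subr_eq raddfD raddfMn -mE => /eqP->.
  by rewrite mulrnDl [LHS](ACl (4*2*(3*1))).
have [i /choice[rho rhoP]] := choice approx.
have [|y yP] := @K_complete rho.
  move=> k l kl; have [w wE] := rhoP k; have [w' wE'] := rhoP l.
  have [m mE] := factE k.
  have [q qE] : exists q, l`! = (q * k`!)%N
    by exists ('C(l, k) * (l - k)`!)%N; rewrite -(bin_fact kl) -mulnA [(k`! * _)%N]mulnC.
  have eq1 : e1 *~ (i l - i k) + cext_inj f (u *~ (rho l - rho k)) = (w - w' *+ q) *+ m.+1.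
    rewrite !mulrzBr [cext_inj f _]raddfB -mE mulrnBl -mulrnA -qE.
    by apply: sub_eq_add3; rewrite -wE -wE'.
  have [c iE] : exists c : int, i l - i k = c * m.+1%:Z.
    apply: (@u_indiv _ _ (cext_proj (w - w' *+ q))).
    have := congr1 (@cext_proj _ _ f) eq1; rewrite addrC -[cext_inj _ _]mulr1n proj_e1.
    by rewrite mul0rn add0r => ->; rewrite raddfMn.
  set v := w - w' *+ q - e1 *~ c.
  have vE : cext_inj f (u *~ (rho l - rho k)) = v *+ m.+1.
    by rewrite mulrnBl -eq1 iE mulrzA -pmulrn [RHS]addrAC subrr add0r.
  have v0 : cext_proj v = 0 by apply: (@K_tf _ m); rewrite -raddfMn -vE.
  rewrite mE; apply: (u_indiv (y := v.2)).
  by move: vE; rewrite (cext_ker v0) -raddfMn => -[].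
exists y => m; have [w wE] := rhoP m.+1; have [z zE] := yP m.+1.
exists ((w - cext_inj f z) *+ m`!), (i m.+1).
rewrite -mulrnA mulnC -factS mulrnBl wE zE injDMn.
by rewrite opprD !addrA [LHS](ACl (3*5*1*(2*4)))/= subrr addr0.
Qed.

(** The extension of [K] by itself is the sum of [K] and of the subgroup [E0] of
    elements of residue zero.  The intersection of both is divisible, hence has
    a complement [S] in [E0], which is a complement of [K]; [S] is the graph of
    the function [T]. *)
Lemma cocycle_splits :
  exists T : K -> K, forall x y, T (x + y) = T x + T y + f x y.
Proof.
have D_0 : D 0 by split=> //; exact: raddf0.
have D_B : sub_closed D.
  by move=> x y [Ex x0] [Ey y0]; split; [exact: E0_B|rewrite projB x0 y0 subrr].
have DE : (D `<=` E0)%classic by move=> x [].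
have [S [S0 SB SE SD Scompl]] := divisible_complement E_tf E0_0 E0_B D_0 D_B DE D_div.
have /choice[T TS] : forall x : K, exists a : K, S (x, a).
  move=> x; have [y Ey] := E0_inj (x, 0); have [d [_ d0] Sd] := Scompl _ Ey.
  set s := (_ - _) in Sd; exists s.2; suff <- : s.1 = x by case: (s) Sd.
  change (cext_proj s = x); rewrite !projB d0 subr0.
  exact: subr0.
exists T => x y.
pose g z : E := (z, T z).
have St : S (g (x + y) - (g x + g y)).
  apply: (SB); first exact: TS.
  rewrite -[g y]opprK; apply: (SB); first exact: TS.
  by rewrite -sub0r; apply: (SB) => //; exact: TS.
move: St; set t := (_ - _) => St.
have t0 : cext_proj t = 0 by rewrite /t projB; exact: subrr.
have : t = 0 by apply: SD => //; split=> //; apply: SE.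
by move/subr0_eq => -[].
Qed.

End Splitting.

(** * Rings with the residues of the integers *)

(** Torsion-free with R / mR = Z / mZ for all m > 0: the second clause says that
    Z maps onto R / mR, the third that the kernel is mZ. *)
Definition integer_residues (R : pzRingType) :=
  [/\ torsion_free R,
      forall m (x : R), exists y i, (i < m.+1)%N /\ x = y *+ m.+1 + i%:R
    & forall m (i : int) (y : R), i%:~R = y *+ m.+1 -> exists c : int, i = c * m.+1%:Z].

Lemma integer_residues_int : integer_residues int.
Proof.
split=> [x m|m x|m i y].
- by move/eqP; rewrite mulrn_eq0 => /eqP.
- exists (x %/ m.+1)%Z, (absz (x %% m.+1)%Z); split.
    by have := ltz_pmod x (isT : (0 < m.+1%:Z)); have := modz_ge0 x (isT : m.+1%:Z != 0); lia.
  rewrite -mulr_natr !natz gez0_abs ?modz_ge0 //; exact: divz_eq.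
- by rewrite intz => ->; exists y; rewrite -mulr_natr natz.
Qed.

Lemma ufilter_pigeonhole m (P : nat -> nat -> Prop) :
  (\forall j \near ufilter, exists2 i, (i < m)%N & P i j) ->
  exists2 i, (i < m)%N & \forall j \near ufilter, P i j.
Proof.
move=> H; apply: contrapT => nex.
have : \forall j \near ufilter, forall i : 'I_m, ~ P i j.
  by apply: filter_forall => i; apply/ufilterNN => Pi; apply: nex; exists i.
move=> nP; have [j [[i im Pij]]] := filter_ex (filterI H nP).
by move/(_ (Ordinal im)).
Qed.

Lemma ucls_nat (R : pzRingType) i : i%:R = ucls (fun=> i%:R) :> upow R.
Proof. exact: uclsMn. Qed.

Lemma ucls_int (R : pzRingType) (i : int) : i%:~R = ucls (fun=> i%:~R) :> upow R.
Proof.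
case: i => i; first by rewrite -!pmulrn ucls_nat.
by rewrite NegzE !mulrNz -!pmulrn ucls_nat uclsN.
Qed.

Section Upow.
Variables (R : pzRingType) (Rres : integer_residues R).

Lemma integer_residues_upow : integer_residues (upow R).
Proof.
have [R_tf res indiv] := Rres; split.
- move=> u m; case: (ucls_surj u) => x <-; rewrite uclsMn => /uclsP xm0.
  by apply/uclsP; apply: filterS xm0 => j; apply: R_tf.
- move=> m u; case: (ucls_surj u) => x <-.
  have /choice[y yP] : forall j, exists y, exists2 i, (i < m.+1)%N & x j = y *+ m.+1 + i%:R.
    by move=> j; have [y [i [im ->]]] := res m (x j); exists y; exists i.
  have [i im xy] := @ufilter_pigeonhole m.+1 (fun i j => x j = y j *+ m.+1 + i%:R) (filterE _ yP).
  exists (ucls y), i; split=> //; rewrite ucls_nat uclsMn uclsD.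
  exact/uclsP.
- move=> m i u; case: (ucls_surj u) => y <-; rewrite uclsMn ucls_int.
  by move/uclsP/filter_ex => [j /indiv].
Qed.

(** The sequence [rho] itself represents an element with all these residues: this
    is where the ultrapower is saturated and [R] need not be. *)
Lemma upow_complete (rho : nat -> int) :
  (forall k l, (k <= l)%N -> exists c : int, rho l - rho k = c * k`!%:Z) ->
  exists y : upow R, forall k, exists z, y = (rho k)%:~R + z *+ k`!.
Proof.
move=> rhoP; exists (ucls (fun j => (rho j)%:~R)) => k.
have /choice[c cP] : forall l, exists c : int, (k <= l)%N -> rho l - rho k = c * k`!%:Z.
  move=> l; case: (boolP (k <= l)%N) => kl; last by exists 0.
  by have [c cE] := rhoP _ _ kl; exists c.
exists (ucls (fun l => (c l)%:~R)); rewrite ucls_int uclsMn uclsD; apply/uclsP.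
apply: filterS (ufilter_ge k) => l /cP E.
by rewrite -[rho l](subrK (rho k)) E addrC rmorphD rmorphM /= -pmulrn mulr_natr.
Qed.

Lemma upow_cocycle_splits (f : sym_cocycle (upow R) (upow R)) :
  exists T : upow R -> upow R, forall x y, T (x + y) = T x + T y + f x y.
Proof.
have [tf res indiv] := integer_residues_upow.
apply: (cocycle_splits tf _ indiv upow_complete) => x m.
by have [y [i [_ ->]]] := res m x; exists y, i.
Qed.

End Upow.

Section Coordinates.
Variables (B A : zmodType) (I : finType) (f : sym_cocycle B {ffun I -> A}) (p : I).

Definition coord_cocycle : sym_cocycle B A.
Proof.
exists (fun x y => f x y p) => [x|x|x y z|x y].
- by rewrite cocycle0l ffunE.
- by rewrite cocycle0r ffunE.
- by have /ffunP/(_ p) := cocycleD f x y z; rewrite !ffunE.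
- by rewrite cocycleC.
Defined.

End Coordinates.

Section UpowCocycle.
Variables (R : pzRingType) (I : finType) (f : sym_cocycle R {ffun I -> R}).

Let uf (u v : upow R) : {ffun I -> upow R} :=
  [ffun p => umap2 (fun x y => f x y p) u v].

Definition upow_cocycle : sym_cocycle (upow R) {ffun I -> upow R}.
Proof.
exists uf => [u|u|u v w|u v]; apply/ffunP => p; rewrite !ffunE.
- case: (ucls_surj u) => x <-; rewrite umap2E.
  by apply/uclsP/filterE => j; rewrite cocycle0l ffunE.
- case: (ucls_surj u) => x <-; rewrite umap2E.
  by apply/uclsP/filterE => j; rewrite cocycle0r ffunE.
- case: (ucls_surj u) (ucls_surj v) (ucls_surj w) => x <- [y <-] [z <-].
  rewrite (uclsD x) (uclsD y) !umap2E (uclsD (fun j => f (x j + y j) (z j) p)) uclsD.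
  apply/uclsP/filterE => j.
  by have /ffunP/(_ p) := cocycleD f (x j) (y j) (z j); rewrite !ffunE.
- case: (ucls_surj u) (ucls_surj v) => x <- [y <-]; rewrite !umap2E.
  by apply/uclsP/filterE => j; rewrite cocycleC.
Defined.

End UpowCocycle.

(** The ultrapowers of both groups are isomorphic, since the cocycles split over the
    ultrapower of [R]. *)
Lemma elem_equiv_N2 n (R : pzRingType) (f : 'I_n -> sym_cocycle R {ffun ltpair n -> R}) :
  integer_residues R -> elem_equiv (N2_0 n R) (N2 f).
Proof.
move=> Rres; apply/elem_equiv_sym/(elem_equiv_trans (elem_equiv_upow _)).
apply/(elem_equiv_trans (H := N2 (fun k => upow_cocycle (f k)))).
  apply: elem_equiv_isomorphic; apply: upow_N2 => k x y p.
  by rewrite /= ffunE umap2E.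
apply/(elem_equiv_trans (H := N2_0 n (upow R))); last first.
  exact/elem_equiv_sym/elem_equiv_upow_N2_0.
have /choice[T TP] : forall q : 'I_n * ltpair n, exists T : upow R -> upow R,
    forall x y, T (x + y) = T x + T y + upow_cocycle (f q.1) x y q.2.
  by case=> k p; apply: (upow_cocycle_splits Rres (coord_cocycle (upow_cocycle (f k)) p)).
apply/elem_equiv_isomorphic/(@N2_cohomologous _ _ _ _ (fun k x p => - T (k, p) x)).
move=> k x y p; have -> : zero_cocycle (upow R) {ffun ltpair n -> upow R} x y p = 0 by rewrite /= ffunE.
by rewrite (TP (k, p)) addr0 opprD addrC subrK opprD.
Qed.

(** * A countable elementary subgroup *)

(** Finite trees of numbers serve as names both for formulas and for elements, so
    that everything named is countable.  Ill-formed trees get a default value. *)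
Notation codes := (GenTree.tree nat).

Fixpoint decode_term (t : codes) k : gterm k :=
  match t with
  | GenTree.Leaf m => if insub m is Some i then GVar i else GOne k
  | GenTree.Node 0 [:: s; t] => GMul (decode_term s k) (decode_term t k)
  | GenTree.Node _ [:: s] => GInv (decode_term s k)
  | _ => GOne k
  end.

Fixpoint decode_formula (t : codes) k : gformula k :=
  match t with
  | GenTree.Node 0 [:: s; t] => GEq (decode_term s k) (decode_term t k)
  | GenTree.Node 1 [:: p] => GNot (decode_formula p k)
  | GenTree.Node 2 [:: p; q] => GAnd (decode_formula p k) (decode_formula q k)
  | GenTree.Node 3 [:: p; q] => GOr (decode_formula p k) (decode_formula q k)
  | GenTree.Node 4 [:: p; q] => GImp (decode_formula p k) (decode_formula q k)
  | GenTree.Node 5 [:: p] => GAll (decode_formula p k.+1)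
  | GenTree.Node 6 [:: p] => GEx (decode_formula p k.+1)
  | _ => GEq (GOne k) (GOne k)
  end.

Lemma decode_term_surj k (t : gterm k) : exists c, decode_term c k = t.
Proof.
elim: t => [i||s [a <-] t [b <-]|t [a <-]].
- by exists (GenTree.Leaf (val i)); rewrite /= valK.
- by exists (GenTree.Node 1 [::]).
- by exists (GenTree.Node 0 [:: a; b]).
- by exists (GenTree.Node 1 [:: a]).
Qed.

Lemma decode_formula_surj k (p : gformula k) : exists c, decode_formula c k = p.
Proof.
elim: p => {k} [k s t|k p [a <-]|k p [a <-] q [b <-]|k p [a <-] q [b <-]
  |k p [a <-] q [b <-]|k p [a <-]|k p [a <-]].
- have [[a <-] [b <-]] := (decode_term_surj s, decode_term_surj t).
  by exists (GenTree.Node 0 [:: a; b]).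
- by exists (GenTree.Node 1 [:: a]).
- by exists (GenTree.Node 2 [:: a; b]).
- by exists (GenTree.Node 3 [:: a; b]).
- by exists (GenTree.Node 4 [:: a; b]).
- by exists (GenTree.Node 5 [:: a]).
- by exists (GenTree.Node 6 [:: a]).
Qed.

Section CountableSubring.
Variables (n : nat) (K : pzRingType) (Kres : integer_residues K) (d : K).
Local Notation N2K := (N2_0 n K).
Local Notation coordinate := ('I_n + ltpair n)%type.

Definition N2_coord (x : N2K) (c : coordinate) : K :=
  match c with inl i => N2_alpha x i | inr p => N2_gamma x p end.

Definition N2_of_coord (h : coordinate -> K) : N2K :=
  MkN2 _ [ffun i => h (inl i)] [ffun p => h (inr p)].

Lemma quotient_exists m : exists q : K -> K,
  forall x, exists i, (i < m.+1)%N /\ x = q x *+ m.+1 + i%:R.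
Proof. by have [_ res _] := Kres; have [q qP] := choice (res m); exists q. Qed.
Definition quotient m : K -> K := sval (cid (quotient_exists m)).

Lemma witness_exists k (p : gformula k.+1) (e : 'I_k -> N2K) :
  exists y, forall x, gholds p (env_cons x e) -> gholds p (env_cons y e).
Proof.
have [[y py]|np] := pselect (exists y, gholds p (env_cons y e)); first by exists y.
by exists 1%g => x px; case: np; exists x.
Qed.
Definition witness k (p : gformula k.+1) (e : 'I_k -> N2K) : N2K :=
  sval (cid (witness_exists p e)).

(** Names denote elements of [K], so a tuple of group elements is passed as the flat
    list of its coordinates. *)
Definition env_of_seq k (s : seq K) (i : 'I_k) : N2K :=
  N2_of_coord (fun c => nth 0 s (index (i, c) (enum {: 'I_k * coordinate}))).

(** These operations make the hull a subring, put [d] into it, keep its residues and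
    close it under witnesses.  The trees [ts] are passed besides their values [xs]
    because some arguments are parameters and not elements: a divisor, a formula,
    the number of a coordinate. *)
Definition operation (m : nat) (ts : seq codes) (xs : seq K) : K :=
  match m, ts with
  | 0, _ => nth 0 xs 0 - nth 0 xs 1
  | 1, _ => nth 0 xs 0 * nth 0 xs 1
  | 2, _ => d
  | 3, GenTree.Leaf m :: _ => quotient m (nth 0 xs 1)
  | _, GenTree.Leaf k :: GenTree.Leaf c :: p :: _ =>
      nth 0 [seq N2_coord (witness (decode_formula p k.+1) (@env_of_seq k (drop 3 xs))) b
            | b <- enum {: coordinate}] c
  | _, _ => 0
  end.

Fixpoint denote (t : codes) : K :=
  match t with
  | GenTree.Leaf _ => 1
  | GenTree.Node m ts => operation m ts (map denote ts)
  end.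

Definition denotable : {pred K} := fun x => `[< exists t, denote t = x >].

Lemma denotableP x : reflect (exists t, denote t = x) (x \in denotable).
Proof. exact: asboolP. Qed.

Lemma denotable_subring : subring_closed denotable.
Proof.
split=> [|x y /denotableP[s <-] /denotableP[t <-]|x y /denotableP[s <-] /denotableP[t <-]];
  apply/denotableP.
- by exists (GenTree.Leaf 0).
- by exists (GenTree.Node 0 [:: s; t]).
- by exists (GenTree.Node 1 [:: s; t]).
Qed.

Definition denotable_ring := {x : K | x \in denotable}.
HB.instance Definition _ := SubChoice.on denotable_ring.
HB.instance Definition _ :=
  GRing.SubChoice_isSubPzRing.Build K denotable denotable_ring denotable_subring.

Let j : {rmorphism denotable_ring -> K} := val.
Let h : N2_0 n denotable_ring -> N2K :=
  N2_twist (f := fun=> zero_cocycle _ _) (fun=> zero_cocycle _ _) j (fun _ _ _ => 0).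

Lemma N2_coord_of (g : coordinate -> K) c : N2_coord (N2_of_coord g) c = g c.
Proof. by case: c => i /=; rewrite ffunE. Qed.

Lemma N2_coord_eq (x y : N2K) : N2_coord x =1 N2_coord y -> x = y.
Proof. by move=> xy; apply: N2_eqP => i; [apply: (xy (inl i))|apply: (xy (inr i))]. Qed.

Lemma N2_coord_denotable (x : N2_0 n denotable_ring) c : N2_coord (h x) c \in denotable.
Proof.
by case: c => i; rewrite /= ffunE ?big1_eq ?addr0; apply: valP.
Qed.

Lemma denotable_coords (x : N2K) :
  (forall c, N2_coord x c \in denotable) -> exists y, h y = x.
Proof.
move=> xden; pose s c : denotable_ring := exist _ (N2_coord x c) (xden c).
exists (MkN2 _ [ffun i => s (inl i)] [ffun p => s (inr p)]).
by apply: N2_eqP => i; rewrite /= !ffunE ?big1_eq ?addr0.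
Qed.

Lemma witness_denotable k (p : gformula k.+1) (e : 'I_k -> N2_0 n denotable_ring) c :
  N2_coord (witness p (h \o e)) c \in denotable.
Proof.
have [t tp] := decode_formula_surj p.
have /choice[a aP] : forall q : 'I_k * coordinate, exists a,
    denote a = N2_coord (h (e q.1)) q.2.
  by move=> q; apply/denotableP/N2_coord_denotable.
apply/denotableP; exists (GenTree.Node 4 [:: GenTree.Leaf k,
  GenTree.Leaf (index c (enum {: coordinate})), t & [seq a q | q <- enum {: 'I_k * coordinate}]]).
rewrite [LHS]/= tp drop0 (nth_map c) ?index_mem ?mem_enum // nth_index ?mem_enum //.
congr (N2_coord (witness p _) c); apply: funext => i; apply: N2_coord_eq => b.
rewrite N2_coord_of -map_comp (nth_map (i, b)) ?index_mem ?mem_enum //=.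
by rewrite nth_index ?mem_enum //= aP.
Qed.

(** A countable Skolem hull; closure under the witnesses is the Tarski-Vaught
    criterion, and closure under quotients keeps the residues. *)
Lemma countable_elementary_subring :
  exists (R : pzRingType) (j : {rmorphism R -> K}) (t : nat -> K),
  [/\ injective j, elem_equiv (N2_0 n R) (N2_0 n K), forall r, exists k, t k = j r,
      exists r, j r = d & integer_residues R].
Proof.
exists denotable_ring, j, (fun k => if unpickle k is Some c then denote c else 0).
have j_inj : injective j := val_inj.
split=> //.
- apply: (@elem_equiv_Tarski_Vaught _ _ h); first exact: N2_twist_inj.
    by apply: N2_twistM => k x y p; rewrite !ffunE rmorph0 !addr0.
  move=> k p e [x px].
  have [y yE] := denotable_coords (witness_denotable p e).
  by exists y; rewrite yE; apply: (svalP (cid (witness_exists p (h \o e)))) px.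
- move=> r; have /denotableP[c cr] := valP r.
  by exists (pickle c); rewrite pickleK.
- have dden : d \in denotable by apply/denotableP; exists (GenTree.Node 2 [::]).
  by exists (exist _ d dden).
- have [K_tf _ indiv] := Kres; split.
  + by move=> x m /(congr1 j); rewrite rmorphMn rmorph0 => /K_tf x0; apply: j_inj; rewrite x0 rmorph0.
  + move=> m x.
    have [i [im xE]] := svalP (cid (quotient_exists m)) (j x).
    have qden : quotient m (j x) \in denotable.
      have /denotableP[c cx] := valP x; apply/denotableP.
      by exists (GenTree.Node 3 [:: GenTree.Leaf m; c]); rewrite /= cx.
    pose y : denotable_ring := exist _ (quotient m (j x)) qden.
    exists y, i; split=> //; apply: j_inj.
    by rewrite rmorphD rmorphMn rmorph_nat.
  + move=> m i y /(congr1 j); rewrite rmorphMn rmorph_int; exact: indiv.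
Qed.

End CountableSubring.

(** * A cocycle that does not split *)

(** At step [k] there are two candidates for the next residue, which differ by 2^k.
    As 2^k is not a multiple of 2^(k+1) in [K], at most one of them is the residue
    of [t k], and the other is taken. *)
Lemma residue_diagonal (K : pzRingType) (t : nat -> K) : integer_residues K ->
  exists a : nat -> int,
    (forall k l, (k <= l)%N -> exists c : int, a l = a k + c *+ 2 ^ k) /\
    (forall k, ~ exists z, t k = (a k.+1)%:~R + z *+ 2 ^ k.+1).
Proof.
case=> K_tf _ indiv.
pose hit (b : int) k := `[< exists z, t k = b%:~R + z *+ 2 ^ k.+1 >].
pose fix a k : int := if k is k'.+1 then
  (if hit (a k') k' then a k' + 1 *+ 2 ^ k' else a k') else 0.
exists a; split=> [k l|k].
  move=> /subnKC <-; elim: (l - k)%N => [|m [c IH]].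
    by exists 0; rewrite addn0 mul0rn addr0.
  rewrite addnS /=; case: ifP => _; last by exists c.
  by exists (c + 1 *+ 2 ^ m); rewrite IH mulrnDl -mulrnA -expnD [(m + k)%N]addnC addrA.
rewrite /=; case: ifPn => [/asboolP[z ->]|/asboolP //] [z'].
rewrite rmorphD rmorphMn -addrA => /addrI zE.
have [m mE] : exists m, (2 ^ k.+1)%N = m.+1 by exists (2 ^ k.+1).-1; rewrite prednK ?expn_gt0.
have [|c] := indiv m (1 *+ 2 ^ k) (z - z').
  by rewrite mulrnBl -mE zE addrK rmorphMn.
rewrite -mE => cE; have : (2 ^ k)%:Z = c * (2 ^ k.+1)%N%:Z by rewrite -cE natz.
have p0 : (2 ^ k)%:Z != 0 by rewrite eqz_nat expn_eq0.
rewrite expnS PoszM mulrA -[X in X = _]mul1r => /(mulIf p0); lia.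
Qed.

Section ScaledFloor.
Variable a : nat -> int.
Notation K := (upow int).

(** Multiplication by the nonstandard rational number [a_j / 2^j], rounded down; the
    rounding makes it additive only up to a carry. *)
Definition scaled_floor : K -> K := umap (fun j (z : int) => (z * a j %/ 2 ^+ j)%Z).

Lemma scaled_floor0 : scaled_floor 0 = 0.
Proof. by rewrite /scaled_floor umapE; apply/uclsP/filterE => j; rewrite mul0r div0z. Qed.

Lemma scaled_floor_pow2 : scaled_floor (ucls (fun j => 2 ^+ j)) = ucls a.
Proof.
rewrite /scaled_floor umapE; apply/uclsP/filterE => j.
by rewrite mulKz // expf_neq0.
Qed.

Lemma divz_carry (m x y : int) : 0 < m ->
  ((x + y) %/ m)%Z = (x %/ m)%Z + (y %/ m)%Z \/
  ((x + y) %/ m)%Z = (x %/ m)%Z + (y %/ m)%Z + 1.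
Proof.
move=> m0; have m0' : m != 0 by rewrite gt_eqF.
have -> : x + y = ((x %/ m)%Z + (y %/ m)%Z) * m + ((x %% m)%Z + (y %% m)%Z).
  by rewrite {1}(divz_eq x m) {1}(divz_eq y m); ring.
rewrite divzMDl //; have := modz_ge0 x m0'; have := modz_ge0 y m0'.
have := ltz_pmod x m0; have := ltz_pmod y m0.
set r := (x %% m)%Z; set s := (y %% m)%Z => sm rm s0 r0.
case: (ltP (r + s) m) => rs; [left|right].
  by rewrite [((r + s) %/ m)%Z]divz_small ?addr0 //; lia.
have -> : r + s = 1 * m + (r + s - m) by ring.
by rewrite divzMDl // [((r + s - m) %/ m)%Z]divz_small ?addr0 //; lia.
Qed.

Lemma scaled_floor_carry u v :
  scaled_floor (u + v) = scaled_floor u + scaled_floor v \/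
  scaled_floor (u + v) = scaled_floor u + scaled_floor v + 1.
Proof.
case: (ucls_surj u) (ucls_surj v) => x <- [y <-].
rewrite uclsD /scaled_floor !umapE uclsD.
have -> : (1 : K) = ucls (fun=> 1) by [].
rewrite uclsD; case: (@ufilter_or
  (fun j => (((x j + y j) * a j) %/ 2 ^+ j)%Z = ((x j * a j) %/ 2 ^+ j)%Z + ((y j * a j) %/ 2 ^+ j)%Z)
  (fun j => (((x j + y j) * a j) %/ 2 ^+ j)%Z = ((x j * a j) %/ 2 ^+ j)%Z + ((y j * a j) %/ 2 ^+ j)%Z + 1)).
- by apply: filterE => j; rewrite mulrDl; apply: divz_carry; rewrite exprn_gt0.
- by move=> H; left; apply/uclsP.
- by move=> H; right; apply/uclsP.
Qed.

End ScaledFloor.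

Section CarryCocycle.
Variables (R K : pzRingType) (j : {rmorphism R -> K}) (j_inj : injective j).
Variables (F : K -> K) (F0 : F 0 = 0).
Hypothesis F_carry : forall u v, F (u + v) = F u + F v \/ F (u + v) = F u + F v + 1.
Variables (n : nat) (s : 'I_n -> ltpair n -> bool).

(** The additivity defect of [F], written as a boolean so that it lies in [R]
    although [F] takes its values in [K]. *)
Definition carry (x y : R) : R := (F (j x + j y) != F (j x) + F (j y))%:R.

Lemma carryE x y : j (carry x y) = F (j x + j y) - F (j x) - F (j y).
Proof.
rewrite /carry rmorph_nat -addrA -opprD.
have [->|FD] := eqVneq; first by rewrite subrr.
by have [FD'|->] := F_carry (j x) (j y); [rewrite FD' eqxx in FD|rewrite addrC addKr].
Qed.

Definition carry_cocycle (k : 'I_n) : sym_cocycle R {ffun ltpair n -> R}.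
Proof.
exists (fun x y => [ffun p => carry x y *+ s k p]) => [x|x|x y z|x y];
  apply/ffunP => p; rewrite !ffunE.
- by rewrite (_ : carry 0 x = 0) ?mul0rn //; apply: j_inj; rewrite carryE !rmorph0 F0 add0r subr0 subrr.
- by rewrite (_ : carry x 0 = 0) ?mul0rn //; apply: j_inj; rewrite carryE !rmorph0 F0 addr0 subr0 subrr.
- rewrite -!mulrnDl; congr (_ *+ _); apply: j_inj.
  rewrite !rmorphD !carryE !rmorphD addrA.
  set A := F (_ + _ + _); set B := F (j x + j y); set C := F (j y + j z).
  rewrite !addrA [LHS](ACl (1*5*6*3*(2*4)))/= addNr addr0.
  by rewrite [RHS](ACl (1*2*5*6*(3*4)))/= addNr addr0.
- by congr (_ *+ _); apply: j_inj; rewrite !carryE addrAC [j y + j x]addrC.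
Defined.

End CarryCocycle.

Theorem theorem8p4 (n : nat) (G : groupType)
    (n_ge2 : (2 <= n)%N) (G_N2Z : is_N2_over n int G) :
  exists H : groupType,
    [/\ is_QN2 n H,
        elem_equiv G H
      & forall R : comPzRingType, ~ is_N2_over n R H].
Proof.
pose K := upow int; pose d : K := ucls (fun j => 2 ^+ j).
have Kres : integer_residues K := integer_residues_upow integer_residues_int.
have [R [j [t [j_inj RK t_surj [dR dRE] Rres]]]] := countable_elementary_subring n Kres d.
have [a [a_coh a_diag]] := residue_diagonal t Kres.
pose i0 : 'I_n := Ordinal (ltnW n_ge2); pose i1 : 'I_n := Ordinal n_ge2.
pose p0 : ltpair n := exist _ (i0, i1) isT.
pose s (k : 'I_n) (p : ltpair n) := (k == i0) && (p == p0).
pose f := carry_cocycle j_inj (scaled_floor0 a) (scaled_floor_carry a) s.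
exists (N2 f); split.
- by exists R, f, id => //; exists id.
- apply: (elem_equiv_trans (elem_equiv_isomorphic G_N2Z)).
  apply: (elem_equiv_trans (elem_equiv_upow_N2_0 _ _)).
  exact: (elem_equiv_trans (elem_equiv_sym RK) (elem_equiv_N2 _ Rres)).
move=> S isoS.
have [_ res _] := Rres; have [K_tf _ Kindiv] := Kres.
have pow2 k : exists m, (2 ^ k)%N = m.+1 by exists (2 ^ k).-1; rewrite prednK ?expn_gt0.
have d_div k : exists c : K, d = c *+ 2 ^ k.
  exists (ucls (fun l => 2 ^+ (l - k))); rewrite uclsMn; apply/uclsP.
  apply: filterS (ufilter_ge k) => l kl.
  by rewrite -[RHS]mulr_natr natrX -exprD subnK.
(* The remainder of d modulo 2^k in R vanishes, since it does so in K. *)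
have dR_div k : exists c : R, dR = c *+ 2 ^ k.
  have [m mE] := pow2 k; have [c [i [im cE]]] := res m dR.
  suff i0' : i = 0%N by exists c; rewrite mE {1}cE i0' addr0.
  have [w wE] := d_div k.
  have [|e eE] := Kindiv m i (w - j c).
    rewrite mulrnBl -mE -wE -dRE cE rmorphD rmorphMn mE addrC addKr.
    by rewrite rmorph_nat -pmulrn.
  by case: e eE => [[|e]|e] eE; move: eE im; clear; [lia|nia|nia].
have gen_div : two_divisible_mod_center (N2_gen f i0 dR).
  move=> k; have [c cE] := dR_div k; pose y := N2_gen f i0 c.
  exists y, ((y ^+ (2 ^ k))^-1 * N2_gen f i0 dR)%g; split; last by rewrite mulVKg.
  apply: N2_centralV; apply/ffunP => i.
  rewrite /= !ffunE N2_alpha_expg !ffunE.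
  by case: eqP; rewrite ?cE ?addNr // mul0rn oppr0 addr0.
have [z [zC zdiv]] := iso_N2_0_two_divisible n_ge2 isoS gen_div.
have z0 := N2_central n_ge2 zC.
(* Over K the cocycle is the coboundary of scaled_floor, so H embeds into N(K). *)
pose T (k : 'I_n) (x : R) (p : ltpair n) := - (scaled_floor a (j x) *+ s k p).
pose h : N2 f -> N2_0 n K := N2_twist (f := f) (fun=> zero_cocycle _ _) j T.
have hM : {morph h : x y / (x * y)%g}.
  apply: N2_twistM => k x y p; rewrite /= !ffunE addr0 rmorphMn (carryE j (scaled_floor_carry a)) /T.
  by case: (s k p); rewrite ?mulr1n ?mulr0n ?oppr0 ?addr0 // rmorphD [LHS](ACl (1*4*(2*3)))/= subrr add0r.
pose w : N2 f := (N2_gen f i0 dR * z)%g.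
have w_alpha i : N2_alpha w i = if i == i0 then dR else 0.
  by rewrite /w /= !ffunE z0 ffunE addr0.
have h_gamma v :
    N2_gamma (h v) p0 = j (N2_gamma v p0) - scaled_floor a (j (N2_alpha v i0)).
  rewrite /= ffunE (bigD1 i0) //= big1 => [|i /negPf ii0].
    by rewrite addr0 /T /s !eqxx mulr1n.
  by rewrite /T /s ii0 mulr0n oppr0.
(* A 2^k-th root of w in N(K) has second coordinate 0, by torsion-freeness, so the
   power formula has no correction term at (0, 1). *)
have w_residue k : exists v, j (N2_gamma w p0) = ucls a + v *+ 2 ^ k.
  have [y yE] := zdiv k; have hyE := morph_exp hM y (2 ^ k).
  have h_i1 : N2_alpha (h y) i1 = 0.
    have [m mE] := pow2 k; apply: (@K_tf _ m).
    by rewrite -mE -N2_alpha_expg -hyE -yE /= ffunE -/w w_alpha rmorph0.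
  exists (N2_gamma (h y) p0); have := N2_0_gamma_expg (h y) (2 ^ k) p0.
  rewrite [N2_alpha (h y) (val p0).2]h_i1 mulr0 mul0rn addr0 => <-.
  rewrite -hyE -yE h_gamma -/w w_alpha eqxx dRE scaled_floor_pow2.
  by rewrite addrC subrK.
(* The central coordinate of w is the m-th element of R, whose residue modulo
   2^(m+1) was avoided. *)
have [m tm] := t_surj (N2_gamma w p0).
case: (a_diag m); have [v vE] := w_residue m.+1; rewrite tm vE.
have /choice[c cE] : forall l, exists c : int, (m < l)%N -> a l = a m.+1 + c *+ 2 ^ m.+1.
  move=> l; case: (boolP (m < l)%N) => ml; last by exists 0.
  by have [c cE] := a_coh _ _ ml; exists c.
exists (ucls c + v); rewrite mulrnDl addrA; congr (_ + _).
rewrite ucls_int uclsMn uclsD; apply/uclsP.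
by apply: filterS (ufilter_ge m.+1) => l /cE ->; rewrite intz.
Qed.
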